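(* Let $V$ be a real Hilbert space, let $Z \subseteq V$ be a closed subspace with orthogonal complement $Z^{\perp}$ in $V$, and let $C[V]$ be the $\mathrm{C}^*$ Clifford algebra of $V$. Then the supercommutant $C[Z]'$ of $C[Z]$ in $C[V]$ coincides with $C[Z^{\perp}]$: $$C[Z]' = C[Z^{\perp}].$$
   Context: Let $V$ be a real Hilbert space with inner product $(\cdot|\cdot)$. $C(V)$ denotes the complex Clifford algebra of $V$: the (universal) unital associative complex algebra containing and generated by its real subspace $V$ subject to the relations $v^2 = (v|v)\mathbf{1}$ for all $v \in V$. It admits a unique (conjugate-linear, antimultiplicative) involution $^*$ for which every element of $V$ is selfadjoint. It carries a natural norm $\|\cdot\|$, namely the unique algebra norm with the $\mathrm{C}^*$ property $\|a^*a\| = \|a\|^2$; the completion of $C(V)$ in this norm is the $\mathrm{C}^*$ Clifford algebra $C[V]$. The grading automorphism $\gamma$ is the unique (complex algebra) automorphism of $C(V)$ that restricts to $-\mathrm{Id}$ on $V$; it is isometric and extends continuously to $C[V]$. Write $C[V]_{\pm} = \ker(\gamma \mp \mathrm{Id})$ for the even ($+$) and odd ($-$) parts, so $C[V] = C[V]_+ \oplus C[V]_-$. For a closed subspace $W \subseteq V$, $C(W)$ is identified with the unital complex subalgebra of $C(V)$ generated by $W$, and $C[W]$ with its norm closure in $C[V]$. The supercommutant of $C[Z]$ in $C[V]$ is $C[Z]' = C[Z]'_+ \oplus C[Z]'_-$, where $C[Z]'_+ = \{a \in C[V]_+ : ba = ab \text{ for all } b \in C[Z]\}$ and $C[Z]'_-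 = \{a \in C[V]_- : ba = a\gamma(b) \text{ for all } b \in C[Z]\}$. Equivalently, $C[Z]' = \{a \in C[V] : za = \gamma(a)z \text{ for all } z \in Z\}$. *)

(* Defs.v *)
From HB Require Import structures.
From mathcomp Require Import all_boot all_order all_algebra.
From mathcomp Require Import all_classical all_reals all_analysis.
From mathcomp Require Import complex.

Set Implicit Arguments.
Unset Strict Implicit.
Unset Printing Implicit Defensive.

Import Order.TTheory GRing.Theory Num.Theory.
Import numFieldNormedType.Exports.

Local Open Scope classical_set_scope.
Local Open Scope ring_scope.
Local Open Scope complex_scope.

(* Unital complex C*-algebras. The library cannot join its algType (which would
   make the norm of a ring that of Num.NumDomain) with its normed modules, so
   the product and its unit are fields here. As for any normed module over
   R[i], the norm takes its (real, nonnegative) values in R[i]. *)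
HB.mixin Record isCstarAlgebra (R : realType) A
    of CompleteNormedModule R[i] A := {
  cone : A ;
  cmul : A -> A -> A ;
  cmulA : associative cmul ;
  cmul1x : left_id cone cmul ;
  cmulx1 : right_id cone cmul ;
  cmulDl : left_distributive cmul +%R ;
  cmulDr : right_distributive cmul +%R ;
  cmulZl : forall (z : R[i]) a b, cmul (z *: a) b = z *: cmul a b ;
  cmulZr : forall (z : R[i]) a b, cmul a (z *: b) = z *: cmul a b ;
  ler_norm_cmul : forall a b, `|cmul a b| <= `|a| * `|b| ;
  cstar : A -> A ;
  cstarK : involutive cstar ;
  cstarD : {morph cstar : a b / a + b} ;
  cstarZ : forall (z : R[i]) a, cstar (z *: a) = z^* *: cstar a ;
  cstarM : forall a b, cstar (cmul a b) = cmul (cstar b) (cstar a) ;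
  norm_cstar_cmul : forall a, `|cmul (cstar a) a| = `|a| ^+ 2 }.

#[short(type="cstarAlgType")]
HB.structure Definition CstarAlgebra (R : realType) :=
  {A of CompleteNormedModule R[i] A & isCstarAlgebra R A}.

Notation "a ** b" := (cmul a b) (at level 40, left associativity) : ring_scope.

Section HilbertSpace.
Context {R : realType} {V : completeNormedModType R}.

(* Makes the complete space V a real Hilbert space with inner product ip. *)
Definition norm_from_dot (ip : {dot V for idfun}) : Prop :=
  forall v, `|v| ^+ 2 = ip v v.

Definition closed_subspace (Z : set V) : Prop :=
  [/\ Z 0,
      forall (r : R) u v, Z u -> Z v -> Z (r *: u + v)
    & closed Z].

Definition orthogonal_complement (ip : {dot V for idfun}) (Z : set V) : set V :=
  [set v | forall z, Z z -> ip v z = 0].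

End HilbertSpace.

Definition subalgebra {R : realType} {B : algType R[i]} (X : set B) : Prop :=
  [/\ X 1,
      forall (z : R[i]) a b, X a -> X b -> X (z *: a + b)
    & forall a b, X a -> X b -> X (a * b)].

Definition subalgebra_gen {R : realType} {B : algType R[i]} (S : set B) :
    set B :=
  smallest subalgebra S.

Section CliffordAlgebra.
Context {R : realType} {V : completeNormedModType R}.
Variable ip : {dot V for idfun}.

Definition clifford_map (B : algType R[i]) (f : V -> B) : Prop :=
  [/\ forall u v, f (u + v) = f u + f v,
      forall (r : R) v, f (r *: v) = r%:C *: f v
    & forall v, f v * f v = (ip v v)%:C *: 1].

(* Since V generates C, the extension F in the universal property is unique. *)
Definition is_clifford_algebra (C : algType R[i]) (iota : V -> C) : Prop :=
  [/\ clifford_map iota,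
      injective iota,
      subalgebra_gen (range iota) = setT
    & forall (B : algType R[i]) (f : V -> B), clifford_map f ->
        exists F : {lrmorphism C -> B}, forall v, F (iota v) = f v].

End CliffordAlgebra.

Section CstarClifford.
Context {R : realType} {V : completeNormedModType R} {C : algType R[i]}.
Variable iota : V -> C.

Definition is_clifford_involution (star : C -> C) : Prop :=
  [/\ involutive star,
      forall a b, star (a + b) = star a + star b,
      forall (z : R[i]) a, star (z *: a) = z^* *: star a,
      forall a b, star (a * b) = star b * star a
    & forall v, star (iota v) = iota v].

Definition is_cstar_norm (star : C -> C) (N : C -> R) : Prop :=
  [/\ forall a, N a = 0 -> a = 0,
      forall a b, N (a + b) <= N a + N b,
      forall (z : R[i]) a, (N (z *: a))%:C = `|z| * (N a)%:C,
      forall a b, N (a * b) <= N a * N b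
    & forall a, N (star a * a) = N a ^+ 2].

(* A is the completion of the normed *-algebra (C, star, N) along j. *)
Definition is_cstar_completion (star : C -> C) (N : C -> R)
    (A : cstarAlgType R) (j : {linear C -> A}) : Prop :=
  [/\ j 1 = cone,
      forall b c, j (b * c) = j b ** j c,
      forall c, j (star c) = cstar (j c),
      forall c, `|j c| = (N c)%:C
    & dense (range j)].

(* gamma is the continuous extension to A of the automorphism gamma0 of C that
   is - Id on V; both are determined by these conditions. *)
Definition is_grading (A : cstarAlgType R) (j : {linear C -> A})
    (gamma : A -> A) : Prop :=
  continuous gamma /\
  exists2 gamma0 : {lrmorphism C -> C},
    bijective gamma0 /\ (forall v, gamma0 (iota v) = - iota v)
    & forall c, gamma (j c) = j (gamma0 c).

Definition clifford_sub (W : set V) : set C := subalgebra_gen (iota @` W).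

Definition cstar_clifford_sub (A : cstarAlgType R) (j : {linear C -> A})
    (W : set V) : set A :=
  closure (j @` clifford_sub W).

End CstarClifford.

Section Supercommutant.
Context {R : realType} {A : cstarAlgType R}.
Variable gamma : A -> A.

Definition even_part : set A := [set a | gamma a = a].
Definition odd_part : set A := [set a | gamma a = - a].

Definition supercommutant_even (S : set A) : set A :=
  [set a | even_part a /\ forall b, S b -> b ** a = a ** b].
Definition supercommutant_odd (S : set A) : set A :=
  [set a | odd_part a /\ forall b, S b -> b ** a = a ** gamma b].

Definition supercommutant (S : set A) : set A :=
  [set a0 + a1 | a0 in supercommutant_even S & a1 in supercommutant_odd S].

End Supercommutant.

(* Main.v *)
Require Import Defs.
From HB Require Import structures.
From mathcomp Require Import all_boot all_order all_algebra.
From mathcomp Require Import all_classical all_reals all_analysis.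
From mathcomp Require Import complex ring lra.

Set Implicit Arguments.
Unset Strict Implicit.
Unset Printing Implicit Defensive.

Import Order.TTheory GRing.Theory Num.Theory.
Import numFieldNormedType.Exports.

Local Open Scope classical_set_scope.
Local Open Scope ring_scope.
Local Open Scope complex_scope.

(* For a unit vector z of Z, the map P_z b = (b + z gamma(b) z) / 2 fixes every
   a that supercommutes with z and sends x + z y, with x and y in the algebra
   generated by vectors orthogonal to z, to x. Approximate a in C[Z]' by an
   element b of C(V); it lies in the algebra generated by Z^perp and finitely
   many vectors of Z. Orthonormalizing these and applying the corresponding
   maps P_z removes them one by one, leaving an element of C(Z^perp), without
   moving a. The maps are contractive on elements of a fixed parity, so the
   error does not grow; hence a is split into its even and odd parts and b is
   chosen of the same parity. *)

(** * Orthogonal projection onto a closed subspace *)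

Section HilbertProjection.
Context {R : realType} {V : completeNormedModType R}.
Variable ip : {dot V for idfun}.
Implicit Types u v w : V.

Lemma dotC u v : ip u v = ip v u.
Proof. by rewrite hermC expr0 mul1r. Qed.

Lemma dotZl r u v : ip (r *: u) v = r * ip u v.
Proof. by rewrite linearZl_LR. Qed.

Lemma dotZr r u v : ip u (r *: v) = r * ip u v.
Proof. by rewrite dotC dotZl dotC. Qed.

Lemma dotDl u v w : ip (u + v) w = ip u w + ip v w.
Proof. by rewrite linearDl. Qed.

Lemma dotDr u v w : ip w (u + v) = ip w u + ip w v.
Proof. by rewrite linearDr. Qed.

Lemma dotNl u v : ip (- u) v = - ip u v.
Proof. by rewrite linearNl. Qed.

Lemma dotNr u v : ip u (- v) = - ip u v.
Proof. by rewrite linearNr. Qed.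

Definition dotE := (dotDl, dotDr, dotNl, dotNr, dotZl, dotZr).

Hypothesis hV : norm_from_dot ip.

(** A sequence in [Z] minimizing the distance to [v] is Cauchy by the parallelogram law; first-order
    minimality at its limit [p] forces [v - p] to be orthogonal to [Z]. *)
Lemma orthogonal_projection (Z : set V) : closed_subspace Z ->
  forall v, exists2 p, Z p & orthogonal_complement ip Z (v - p).
Proof.
move=> [Z0 ZP Zcl] v.
pose D : set R := [set `|v - z| ^+ 2 | z in Z].
have Dinf : has_inf D.
  split; first by exists (`|v - 0| ^+ 2), 0.
  by exists 0 => _ [z _ <-]; rewrite exprn_ge0.
pose d := inf D.
have dle z : Z z -> d <= `|v - z| ^+ 2.
  by move=> Zz; apply: ge_inf; [exact: Dinf.2|exists z].
have /choice[u uP] (n : nat) : exists z, Z z /\ `|v - z| ^+ 2 < d + n.+1%:R^-1.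
  have e0 : 0 < n.+1%:R^-1 :> R by rewrite invr_gt0 ltr0Sn.
  by have [_ [z Zz <-] h] := inf_adherent e0 Dinf; exists z.
have Zu n : Z (u n) by case: (uP n).
(* Parallelogram law: the midpoint of [u n] and [u m] lies in [Z], so its squared distance to [v] is
   at least [d]. *)
have uB n m : `|u n - u m| ^+ 2 <= 2 * n.+1%:R^-1 + 2 * m.+1%:R^-1.
  have Zmid : Z (2^-1 *: (u n + u m)).
    rewrite -[X in Z X]addr0; apply: (ZP) => //.
    by rewrite -[u n]scale1r; exact: ZP.
  (* The estimate is linear in the inner products, which become variables here; the shape of the
     hypotheses is the one produced by expanding with [dotE]. *)
  have aux (a b e vv vn vm nn nm mm : R) :
      vv - vm + (- vm - - mm) < e + b -> vv - vn + (- vn - - nn) < e + a ->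
      e <= vv - 2^-1 * (vn + vm) + (- (2^-1 * (vn + vm)) -
        - (2^-1 * (2^-1 * (nn + nm) + 2^-1 * (nm + mm)))) ->
      nn - nm + (- nm - - mm) <= 2 * a + 2 * b by lra.
  have := dle _ Zmid; have := (uP n).2; have := (uP m).2.
  rewrite !hV !dotE (dotC (u n) v) (dotC (u m) v) (dotC (u m) (u n)).
  exact: aux.
have ucv : u @ \oo --> lim (u @ \oo).
  apply: cauchy_cvg; apply: cauchy_exP => e e0.
  have e40 : 0 < e ^+ 2 / 4 by rewrite divr_gt0 ?exprn_gt0.
  have [N _ NP] := near_infty_natSinv_lt (PosNum e40).
  exists (u N); exists N => // n /= Nn.
  rewrite -ball_normE /= -(@ltr_pXn2r _ 2) ?nnegrE ?(ltW e0)//.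
  apply: le_lt_trans (uB _ _) _.
  have aux (a b f : R) : a < f / 4 -> b < f / 4 -> 2 * a + 2 * b < f by lra.
  by apply: aux; [exact: (NP _ (leqnn N))|exact: (NP _ Nn)].
set p := lim (u @ \oo) in ucv.
have Zp : Z p.
  by apply: (closed_cvg Z) ucv => //; exact: nearW.
exists p => // z Zz.
have pd : `|v - p| ^+ 2 <= d.
  have vu : (fun n => `|v - u n|) @ \oo --> `|v - p|.
    by apply: cvg_norm; apply: cvgB => //; exact: cvg_cst.
  have dh : (fun n => d + @harmonic R n) @ \oo --> d + 0.
    by apply: cvgD; [exact: cvg_cst|exact: cvg_harmonic].
  rewrite -[leRHS]addr0; apply: (ler_cvg_to (cvgM vu vu) dh).
  by apply: nearW => n; exact: ltW (uP n).2.
(* Compare [p] with the competitor [p + t *: z] and expand. *)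
have q t : 0 <= t ^+ 2 * ip z z - 2 * t * ip (v - p) z.
  have Zpt : Z (p + t *: z) by rewrite addrC; exact: ZP.
  have aux (vv vp pp vz pz zz : R) :
      vv - vp + (- vp - - pp) <=
        vv + (- vp - t * vz) + (- vp - t * vz +
          (- - pp - - (t * pz) + (- - (t * pz) - - (t * (t * zz))))) ->
      0 <= t ^+ 2 * zz - 2 * t * (vz - pz) by lra.
  have := le_trans pd (dle _ Zpt).
  rewrite !hV opprD !dotE (dotC p v) (dotC z v) (dotC z p).
  exact: aux.
have [->|z0] := eqVneq z 0; first by rewrite linear0r.
have zz : 0 < ip z z by rewrite -hV exprn_gt0 // normr_gt0.
(* This [t] minimizes the quadratic in [q]; its minimum [- (x ^+ 2 / y)] is nonnegative only if
   [x = 0]. *)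
have := q (ip (v - p) z / ip z z).
set x := ip (v - p) z; set y := ip z z in zz *.
have -> : (x / y) ^+ 2 * y - 2 * (x / y) * x = - (x ^+ 2 / y) by field; lra.
rewrite oppr_ge0 pmulr_lle0 ?invr_gt0// => x2.
by apply/eqP; rewrite -sqrf_eq0 eq_le x2 sqr_ge0.
Qed.
End HilbertProjection.

Lemma scaler_half_double (R : realType) (L : lmodType R[i]) (x : L) :
  2^-1 *: (x + x) = x.
Proof.
by rewrite -mulr2n -scalerMnr scalerMnl -mulr_natr mulVf ?scale1r.
Qed.

(** * Generated subalgebras *)

Section Subalgebras.
Context {R : realType} {B : algType R[i]}.
Implicit Type S : set B.

Lemma subalgebra_gen_subalgebra S : subalgebra (subalgebra_gen S).
Proof.
split.
- by move=> X [[]].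
- move=> z a b ha hb X [Xalg SX].
  by case: (Xalg) => _ + _; apply; [apply: ha|apply: hb].
- move=> a b ha hb X [Xalg SX].
  by case: (Xalg) => _ _; apply; [apply: ha|apply: hb].
Qed.

Variable X : set B.
Hypothesis hX : subalgebra X.

Lemma subalgebra1 : X 1. Proof. by case: hX. Qed.

Lemma subalgebraM a b : X a -> X b -> X (a * b).
Proof. by case: hX => _ _; apply. Qed.

Lemma subalgebraP (z : R[i]) a b : X a -> X b -> X (z *: a + b).
Proof. by case: hX => _ + _; apply. Qed.

Lemma subalgebra0 : X 0.
Proof.
by rewrite -(addNr 1) -scaleN1r; apply: subalgebraP; exact: subalgebra1.
Qed.

Lemma subalgebraD a b : X a -> X b -> X (a + b).
Proof. by move=> Xa Xb; rewrite -[a]scale1r; exact: subalgebraP. Qed.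

Lemma subalgebraZ (z : R[i]) a : X a -> X (z *: a).
Proof.
move=> Xa; rewrite -[_ *: _]addr0.
by apply: subalgebraP => //; exact: subalgebra0.
Qed.

End Subalgebras.

(** * Clifford relations and the algebraic maps P_z *)

Section CliffordProjection.
Context {R : realType} {V : completeNormedModType R} {C : algType R[i]}.
Variables (ip : {dot V for idfun}) (iota : V -> C).
Hypothesis cliff : clifford_map ip iota.
Variable g : {lrmorphism C -> C}.
Hypothesis g_iota : forall v, g (iota v) = - iota v.

Local Notation Cl := (clifford_sub iota).

Lemma iotaD u v : iota (u + v) = iota u + iota v.
Proof. by case: cliff. Qed.

Lemma iotaZ r v : iota (r *: v) = r%:C *: iota v.
Proof. by case: cliff. Qed.

Lemma iota_sqr v : iota v * iota v = (ip v v)%:C *: 1.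
Proof. by case: cliff. Qed.

(** Polarization: expanding the square of [iota (u + v)], the cross terms must sum to zero. *)
Lemma iota_anticommute u v :
  ip u v = 0 -> iota u * iota v = - (iota v * iota u).
Proof.
move=> uv; have := iota_sqr (u + v).
rewrite iotaD mulrDl !mulrDr !iota_sqr !dotE (dotC ip v u) uv addr0 add0r.
rewrite rmorphD scalerDl -!addrA => /addrI; rewrite addrA.
by move=> /(canRL (addrK _)); rewrite subrr => /eqP; rewrite addr_eq0 => /eqP.
Qed.

Lemma clifford_sub_subalgebra W : subalgebra (Cl W).
Proof. exact: subalgebra_gen_subalgebra. Qed.

Lemma clifford_sub_iota W v : W v -> Cl W (iota v).
Proof. by move=> Wv; apply: sub_gen_smallest; exists v. Qed.

Lemma clifford_sub_le W (X : set C) : subalgebra X ->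
  (forall w, W w -> X (iota w)) -> Cl W `<=` X.
Proof. by move=> hX WX; apply: smallest_sub => // _ [w Ww <-]; exact: WX. Qed.

Lemma clifford_sub_grading W c : Cl W c -> Cl W (g c).
Proof.
have hW := clifford_sub_subalgebra W.
move: c; apply: (@clifford_sub_le W (g @^-1` Cl W)) => [|w Ww].
  split => /=.
  - by rewrite rmorph1; exact: (subalgebra1 hW).
  - by move=> z a b; rewrite linearP; exact: (subalgebraP hW).
  - by move=> a b; rewrite rmorphM; exact: (subalgebraM hW).
rewrite /= g_iota -scaleN1r; apply: (subalgebraZ hW) => //.
exact: clifford_sub_iota.
Qed.

(** For fixed [z] the relation is stable under linear combinations and, [g] being multiplicative,
    under products; on generators it is anticommutation. *)
Lemma iota_clifford_sub W z c : (forall w, W w -> ip w z = 0) -> Cl W c ->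
  iota z * c = g c * iota z.
Proof.
move=> Wz; move: c.
apply: (@clifford_sub_le W [set c | iota z * c = g c * iota z]).
  split=> /=.
  - by rewrite rmorph1 mulr1 mul1r.
  - move=> k a b ha hb.
    by rewrite linearP mulrDr mulrDl -scalerAl -scalerAr ha hb.
  - by move=> a b ha hb; rewrite mulrA ha -mulrA hb mulrA rmorphM.
by move=> w Ww /=; rewrite g_iota mulNr iota_anticommute // dotC Wz.
Qed.

Lemma clifford_sub_iotar W z c : (forall w, W w -> ip w z = 0) -> Cl W c ->
  c * iota z = iota z * g c.
Proof.
move=> Wz; move: c.
apply: (@clifford_sub_le W [set c | c * iota z = iota z * g c]).
  split=> /=.
  - by rewrite rmorph1 mulr1 mul1r.
  - move=> k a b ha hb.
    by rewrite linearP mulrDr mulrDl -scalerAl -scalerAr ha hb.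
  - by move=> a b ha hb; rewrite -mulrA hb mulrA ha -mulrA rmorphM.
by move=> w Ww /=; rewrite g_iota mulrN iota_anticommute // Wz.
Qed.

Definition clifford_proj z b : C := 2^-1 *: (b + iota z * g b * iota z).

Lemma clifford_proj_sub W z b : ip z z = 1 -> (forall w, W w -> ip w z = 0) ->
  Cl (z |` W) b -> Cl W (clifford_proj z b).
Proof.
move=> zz Wz.
have hW := clifford_sub_subalgebra W.
have z2 : iota z * iota z = 1 by rewrite iota_sqr zz scale1r.
(* Normal form x + z y. Since z g(x) z = x and z g(z y) z = - z y, averaging with the identity keeps
   x and kills z y. *)
pose X := [set b | exists x y, [/\ Cl W x, Cl W y & b = x + iota z * y]].
have XP : Cl (z |` W) `<=` X.
  apply: clifford_sub_le; first split.
  - exists 1, 0; split; [exact: (subalgebra1 hW)|exact: (subalgebra0 hW)|].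
    by rewrite mulr0 addr0.
  - move=> k _ _ [x [y [Wx Wy ->]]] [x' [y' [Wx' Wy' ->]]].
    exists (k *: x + x'), (k *: y + y'); split; try exact: (subalgebraP hW).
    by rewrite mulrDr scalerDr -scalerAr addrACA.
  - move=> _ _ [x [y [Wx Wy ->]]] [x' [y' [Wx' Wy' ->]]].
    (* In (x + z y)(x' + z y'), moving z to the left past x or y applies [g], and z z = 1. *)
    exists (x * x' + g y * y'), (g x * y' + y * x').
    have Wgx := clifford_sub_grading Wx; have Wgy := clifford_sub_grading Wy.
    split; try by apply: (subalgebraD hW) => //; exact: (subalgebraM hW).
    rewrite mulrDl !mulrDr -!mulrA (mulrA x) (clifford_sub_iotar Wz Wx).
    rewrite (mulrA y) (clifford_sub_iotar Wz Wy) !mulrA z2 mul1r -!addrA.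
    by congr (_ + _); rewrite addrA addrC.
  - move=> w [->|Ww].
      exists 0, 1; split; [exact: (subalgebra0 hW)|exact: (subalgebra1 hW)|].
      by rewrite mulr1 add0r.
    exists (iota w), 0; rewrite mulr0 addr0; split=> //.
      exact: clifford_sub_iota.
    exact: (subalgebra0 hW).
move=> /XP[x [y [Wx Wy ->]]]; rewrite /clifford_proj.
rewrite rmorphD rmorphM /= g_iota mulrDr mulrDl mulNr mulrN mulrA z2 mul1r.
rewrite mulNr.
rewrite -(iota_clifford_sub Wz Wy) -(clifford_sub_iotar Wz Wx) -mulrA z2 mulr1.
by rewrite addrACA subrr addr0 scaler_half_double.
Qed.

Hypothesis iota_gen : subalgebra_gen (range iota) = setT.

Lemma gradingK : involutive g.
Proof.
move=> c; have : subalgebra_gen (range iota) c by rewrite iota_gen.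
move: c; apply: (@smallest_sub _ _ _ [set c | g (g c) = c]); first split=> /=.
- by rewrite !rmorph1.
- by move=> k a b ha hb; rewrite !linearP /= ha hb.
- by move=> a b ha hb; rewrite !rmorphM /= ha hb.
- by move=> _ [v _ <-] /=; rewrite g_iota raddfN /= g_iota opprK.
Qed.

Hypothesis hV : norm_from_dot ip.
Variable Z : set V.
Hypothesis hZ : closed_subspace Z.

Local Notation Zperp := (orthogonal_complement ip Z).

Lemma clifford_sub_le2 W W' : (forall w, W w -> Cl W' (iota w)) ->
  Cl W `<=` Cl W'.
Proof.
by move=> WW; apply: clifford_sub_le => //; exact: clifford_sub_subalgebra.
Qed.

(** An algebraic element involves finitely many vectors; each splits into its projection on [Z],
    recorded in [ps], and a remainder in [Zperp]. *)
Lemma clifford_sub_exhaust b : exists ps : seq V,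
  (forall p, p \in ps -> Z p) /\ Cl ([set` ps] `|` Zperp) b.
Proof.
have : subalgebra_gen (range iota) b by rewrite iota_gen.
have catl ps qs : Cl ([set` ps] `|` Zperp) `<=` Cl ([set` ps ++ qs] `|` Zperp).
  apply: clifford_sub_le2 => w [/= wp|Zw]; apply: clifford_sub_iota;
    [left|by right].
  by rewrite /= mem_cat wp.
have catr ps qs : Cl ([set` qs] `|` Zperp) `<=` Cl ([set` ps ++ qs] `|` Zperp).
  apply: clifford_sub_le2 => w [/= wp|Zw]; apply: clifford_sub_iota;
    [left|by right].
  by rewrite /= mem_cat wp orbT.
have catZ (ps qs : seq V) :
    (forall p, p \in ps -> Z p) -> (forall p, p \in qs -> Z p) ->
    forall p, p \in ps ++ qs -> Z p.
  by move=> hp hq p; rewrite mem_cat => /orP[/hp|/hq].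
move: b; apply: smallest_sub; first split=> /=.
- by exists [::]; split=> //; exact: (subalgebra1 (clifford_sub_subalgebra _)).
- move=> k a b [ps [Zps aps]] [qs [Zqs bqs]]; exists (ps ++ qs).
  split; first exact: catZ.
  apply: (subalgebraP (clifford_sub_subalgebra _)); first exact: catl.
  exact: catr.
- move=> a b [ps [Zps aps]] [qs [Zqs bqs]]; exists (ps ++ qs).
  split; first exact: catZ.
  apply: (subalgebraM (clifford_sub_subalgebra _)); first exact: catl.
  exact: catr.
move=> _ [v _ <-]; have [p Zp vp] := orthogonal_projection hV hZ v.
exists [:: p]; split => [q|]; first by rewrite inE => /eqP->.
rewrite -(subrK p v) iotaD; apply: (subalgebraD (clifford_sub_subalgebra _)).
  by apply: clifford_sub_iota; right.
by apply: clifford_sub_iota; left; rewrite /= mem_head.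
Qed.

(** One Gram-Schmidt step: [z] stands for the normalized [p], and the other vectors lose their
    component along [z]. *)
Lemma clifford_sub_gram_schmidt z p ps : p = ip p z *: z ->
  Cl ([set` p :: ps] `|` Zperp) `<=`
  Cl (z |` ([set` [seq q - ip q z *: z | q <- ps]] `|` Zperp)).
Proof.
move=> pz; set W := z |` _.
have hW := clifford_sub_subalgebra W.
have Wz : Cl W (iota z) by apply: clifford_sub_iota; left.
apply: clifford_sub_le2 => q [|Zq]; last first.
  by apply: clifford_sub_iota; right; right.
rewrite /= inE => /orP[/eqP->|qps].
  by rewrite pz iotaZ; exact: (subalgebraZ hW).
rewrite -(subrK (ip q z *: z) q) iotaD iotaZ addrC.
apply: (subalgebraP hW) => //.
by apply: clifford_sub_iota; right; left; rewrite /=; apply/mapP; exists q.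
Qed.

End CliffordProjection.

(** * Continuity and norm estimates in a C*-algebra *)

Section CstarAlgebras.
Context {R : realType} {A : cstarAlgType R}.
Implicit Types a b x : A.

Lemma cmulNr a b : a ** (- b) = - (a ** b).
Proof. by rewrite -scaleN1r cmulZr scaleN1r. Qed.

Lemma cmulNl a b : (- a) ** b = - (a ** b).
Proof. by rewrite -scaleN1r cmulZl scaleN1r. Qed.

Lemma cmulBr a b x : a ** (b - x) = a ** b - a ** x.
Proof. by rewrite cmulDr cmulNr. Qed.

Lemma cmulBl a b x : (a - b) ** x = a ** x - b ** x.
Proof. by rewrite cmulDl cmulNl. Qed.

Lemma lipschitz_continuous (f : A -> A) (k : R[i]) : 0 <= k ->
  (forall a b, `|f a - f b| <= k * `|a - b|) -> continuous f.
Proof.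
move=> k0 fk a; apply/cvgrPdist_lt => e e0.
(* The constant [k] may vanish, so [k + 1] serves as the divisor. *)
have k1 : 0 < k + 1 by rewrite ltr_wpDl.
near=> b; apply: le_lt_trans (fk _ _) _.
apply: (@le_lt_trans _ _ ((k + 1) * `|a - b|)).
  by rewrite ler_wpM2r// lerDl.
rewrite mulrC -ltr_pdivlMr//.
near: b; by apply: cvgr_dist_lt; [exact: cvg_id|exact: divr_gt0].
Unshelve. all: by end_near. Qed.

Lemma cmull_continuous a : continuous (cmul a).
Proof.
apply: (@lipschitz_continuous _ `|a|) => // x y.
by rewrite -cmulBr ler_norm_cmul.
Qed.

Lemma cmulr_continuous a : continuous (fun x => x ** a).
Proof.
apply: (@lipschitz_continuous _ `|a|) => // x y.
by rewrite -cmulBl mulrC ler_norm_cmul.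
Qed.

(** The difference of the two maps is continuous and {0} is closed. *)
Lemma eq_on_closure (f h : A -> A) (S : set A) : continuous f -> continuous h ->
  (forall x, S x -> f x = h x) -> forall x, closure S x -> f x = h x.
Proof.
move=> cf ch fh x Sx; apply: subr0_eq.
have c0 : closed [set (0 : A)].
  exact/accessible_closed_set1/hausdorff_accessible/norm_hausdorff.
have cfh : continuous (fun y => f y - h y).
  by move=> y; apply: cvgB; [exact: cf|exact: ch].
have /continuous_closedP/(_ _ c0) cl := cfh.
apply: cl; apply: closure_subset Sx => y Sy /=.
by rewrite fh// subrr.
Qed.

Lemma cstar_cone : cstar (cone : A) = cone.
Proof. by rewrite -[RHS]cstarK -[cstar cone]cmulx1 cstarM cstarK cmulx1. Qed.

(** The C*-identity gives |a|^2 = |1|. It will apply to the images of unit vectors of [Z]. *)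
Lemma selfadjoint_norm_le1 a : cstar a = a -> a ** a = cone -> `|a| <= 1.
Proof.
move=> sa aa.
(* The norm of the unit equals its own square, so it is 0 (zero algebra) or 1. *)
have c1 : `|cone : A| <= 1.
  have := norm_cstar_cmul (cone : A); rewrite cstar_cone cmulx1.
  have [->//|c0] := eqVneq `|cone : A| 0.
  by rewrite -[LHS]mulr1 expr2 => /(mulfI c0) <-.
by rewrite -(@expr_le1 _ 2)// -norm_cstar_cmul sa aa.
Qed.

End CstarAlgebras.

(** * Supercommutants, treated one parity at a time *)

Section Supercommutant.
Context {R : realType} {V : completeNormedModType R} {C : algType R[i]}.
Variables (ip : {dot V for idfun}) (iota : V -> C).
Hypothesis hV : norm_from_dot ip.
Hypothesis cliff : clifford_map ip iota.
Hypothesis iota_gen : subalgebra_gen (range iota) = setT.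
Variable g : {lrmorphism C -> C}.
Hypothesis g_iota : forall v, g (iota v) = - iota v.
Variables (A : cstarAlgType R) (j : {linear C -> A}).
Hypothesis j1 : j 1 = cone.
Hypothesis jM : forall b c, j (b * c) = j b ** j c.
Hypothesis j_iota : forall v, cstar (j (iota v)) = j (iota v).
Hypothesis j_dense : dense (range j).
Variable gamma : A -> A.
Hypothesis gamma_cont : continuous gamma.
Hypothesis gamma_j : forall c, gamma (j c) = j (g c).
Variable Z : set V.
Hypothesis hZ : closed_subspace Z.

Local Notation Cl := (clifford_sub iota).
Local Notation Zperp := (orthogonal_complement ip Z).

(* The even part of a for s = 1 and its odd part for s = -1. *)
Definition parity_part (s : R[i]) (a : A) : A := 2^-1 *: (a + s *: gamma a).

Lemma parity_part_continuous s : continuous (parity_part s).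
Proof.
move=> a; apply: cvgZr; apply: cvgD; first exact: cvg_id.
by apply: cvgZr; exact: gamma_cont.
Qed.

Lemma parity_part_j s c : parity_part s (j c) = j (2^-1 *: (c + s *: g c)).
Proof.
rewrite /parity_part gamma_j (linearZ_LR j) (raddfD j)/= (linearZ_LR j).
by [].
Qed.

Lemma closure_range_j a : closure (range j) a.
Proof.
move=> B; rewrite nbhsE => -[U [Uo Ua] UB].
have [x [Ux jx]] := j_dense (ex_intro _ a Ua) Uo.
exists x; split; [exact: jx|exact: UB].
Qed.

Lemma parity_part_id s a : s * s = 1 -> gamma a = s *: a -> parity_part s a = a.
Proof.
move=> ss ga; by rewrite /parity_part ga scalerA ss scale1r scaler_half_double.
Qed.

Section Parity.
Variable s : R[i].
Hypothesis ss : s * s = 1.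

Lemma grading_parity c :
  g (2^-1 *: (c + s *: g c)) = s *: (2^-1 *: (c + s *: g c)).
Proof.
rewrite (linearZ_LR g) (raddfD g)/= (linearZ_LR g)/= (gradingK g_iota iota_gen).
by rewrite !scalerDr !scalerA [s * _ * s]mulrAC ss mul1r addrC (mulrC s).
Qed.

(** Linearity of [gamma] is not among the assumptions: the identity is checked on the dense image of
    [j], where [gamma] comes from [g], and extended by continuity. *)
Lemma gamma_parity_part a : gamma (parity_part s a) = s *: parity_part s a.
Proof.
apply: (@eq_on_closure _ _ (gamma \o parity_part s)
  (fun a => s *: parity_part s a) (range j)); last exact: closure_range_j.
- move=> x; apply: continuous_comp; first exact: parity_part_continuous.
  exact: gamma_cont.
- by move=> x; apply: cvgZr; exact: parity_part_continuous.
move=> _ [c _ <-] /=.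
by rewrite parity_part_j gamma_j -(linearZ_LR j) grading_parity.
Qed.

Hypothesis ns : `|s| = 1.

(** An average of two elements of norm at most |d|. On elements of parity [s], the map P_z takes
    this form with [e] the image of z. *)
Lemma half_conj_contract e d : `|e| <= 1 ->
  `|2^-1 *: (d + s *: (e ** d ** e))| <= `|d : A|.
Proof.
move=> e1.
have ede : `|e ** d ** e| <= `|d|.
  apply: le_trans (ler_norm_cmul _ _) _; rewrite -[leRHS]mulr1.
  apply: ler_pM => //; apply: le_trans (ler_norm_cmul _ _) _.
  by rewrite ler_piMl.
rewrite normrZ ger0_norm ?invr_ge0// mulrC ler_pdivrMr//.
apply: le_trans (ler_normD _ _) _.
by rewrite normrZ ns mul1r mulr_natr mulr2n lerD2l.
Qed.

Variable a : A.
Hypothesis ga : gamma a = s *: a.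
Hypothesis sa : forall z, Z z -> j (iota z) ** a = s *: (a ** j (iota z)).

Lemma supercommuting_approx_gens (ps : seq V) b e :
  (forall p, p \in ps -> Z p) ->
  Cl ([set` ps] `|` Zperp) b -> g b = s *: b -> `|a - j b| < e ->
  exists2 c, Cl Zperp c & `|a - j c| < e.
Proof.
(* Induction on a bound for the length, because orthogonalization replaces the tail by another
   list. *)
have [n] := ubnP (size ps).
elim: n ps b => // n IH [|p ps] b /= psn Zps bps gb ab.
  exists b => //; move: bps.
  apply: (clifford_sub_le2 (iota := iota)) => w [//|Zw].
  exact: clifford_sub_iota.
(* A zero vector, which arises from linear dependence among the vectors, cannot be normalized; it
   adds nothing to the algebra and is dropped. *)
have [p0|p0] := eqVneq p 0.
  apply: (IH ps b) => //.
    by move=> q qps; apply: Zps; rewrite inE qps orbT.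
  move: bps; apply: (clifford_sub_le2 (iota := iota)) => w [/=|Zw].
    rewrite inE => /orP[/eqP->|wps]; last by apply: clifford_sub_iota; left.
    rewrite p0 -[0](scale0r (0 : V)) (iotaZ cliff).
    rewrite scale0r; exact: (subalgebra0 (clifford_sub_subalgebra _ _)).
  by apply: clifford_sub_iota; right.
have np0 : `|p| != 0 by rewrite normr_eq0.
pose z := `|p|^-1 *: p.
have zz : ip z z = 1.
  by rewrite /z !dotE -hV expr2 mulKf// mulVf.
have pz : p = ip p z *: z.
  by rewrite /z !dotE -hV expr2 mulKf// scalerA divff// scale1r.
have [Z0 ZP _] := hZ.
have ZZ r q : Z q -> Z (r *: q) by move=> Zq; rewrite -[_ *: _]addr0; exact: ZP.
have Zz : Z z by apply: ZZ; apply: Zps; rewrite mem_head.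
pose ps' := [seq q - ip q z *: z | q <- ps].
have Wz w : ([set` ps'] `|` Zperp) w -> ip w z = 0.
  move=> [/mapP[q _ ->]|]; last exact.
  by rewrite dotDl dotNl dotZl zz mulr1 subrr.
have bz := clifford_sub_gram_schmidt cliff pz bps.
have cz := clifford_proj_sub cliff g_iota zz Wz bz.
apply: (IH ps' (clifford_proj iota g z b)) => //.
- by rewrite size_map.
- move=> _ /mapP[q qps ->]; rewrite addrC -scaleNr; apply: ZP => //.
  by apply: Zps; rewrite inE qps orbT.
(* P_z preserves parity: the two signs from [g] on the outer factors z cancel. *)
- rewrite /clifford_proj (linearZ_LR g) (raddfD g)/= !rmorphM/= g_iota.
  rewrite (gradingK g_iota iota_gen) gb -scalerAr -scalerAl scalerDr scalerA.
  rewrite !(mulNr, mulrN) opprK !scalerDr !scalerA.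
  by rewrite [s * _ * s]mulrAC ss mul1r (mulrC s).
have := sa Zz; set x := j (iota z) => xa.
have xx : x ** x = cone by rewrite /x -jM (iota_sqr cliff) zz scale1r j1.
have x1 : `|x| <= 1 by apply: selfadjoint_norm_le1 => //; exact: j_iota.
(* Supercommutation with z, together with z z = 1, makes [a] a fixed point of P_z. *)
have xax : s *: (x ** a ** x) = a.
  by rewrite xa cmulZl scalerA ss scale1r -cmulA xx cmulx1.
have jproj :
    j (clifford_proj iota g z b) = 2^-1 *: (j b + s *: (x ** j b ** x)).
  rewrite /clifford_proj (linearZ_LR j) (raddfD j)/= !jM gb.
  by rewrite (linearZ_LR j) cmulZr cmulZl.
apply: le_lt_trans ab.
(* As [a] is fixed, the new error is the contractive map applied to the old error. *)
suff -> : a - j (clifford_proj iota g z b) =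
    2^-1 *: (a - j b + s *: (x ** (a - j b) ** x)) by exact: half_conj_contract.
rewrite cmulBr cmulBl scalerBr xax addrACA -opprD scalerBr -jproj.
by rewrite scaler_half_double.
Qed.

Lemma supercommuting_in_closure : closure (j @` Cl Zperp) a.
Proof.
move=> B /nbhs_ballP[e /= e0 aB].
have /nbhs_ballP : nbhs a (ball a e) by exact: nbhsx_ballx.
(* [parity_part s] is continuous and fixes [a], so density yields [c] whose part of parity [s] is
   within [e] of [a]. *)
have := @parity_part_continuous s a (ball a e).
rewrite parity_part_id// => /(_ (nbhsx_ballx a e e0)) aE.
have [_ [[c _ <-] /=]] := closure_range_j aE.
rewrite parity_part_j -ball_normE /= => ac _.
have [ps [Zps cps]] := clifford_sub_exhaust cliff iota_gen hV hZ
  (2^-1 *: (c + s *: g c)).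
have [d dZ ad] := supercommuting_approx_gens Zps cps (grading_parity c) ac.
by exists (j d); split; [exists d|apply: aB; rewrite -ball_normE].
Qed.

End Parity.

(** The even and odd summands are approximated separately, with [s = 1] and [s = -1], each within
    half the allowed error. *)
Lemma supercommutant_sub :
  supercommutant gamma (cstar_clifford_sub iota j Z) `<=`
  cstar_clifford_sub iota j Zperp.
Proof.
have Zj z : Z z -> cstar_clifford_sub iota j Z (j (iota z)).
  move=> Zz; apply: subset_closure; exists (iota z) => //.
  exact: clifford_sub_iota.
move=> _ [a0 [ga0 ha0] [a1 [ga1 ha1] <-]].
have c0 : cstar_clifford_sub iota j Zperp a0.
  apply: (@supercommuting_in_closure 1); rewrite ?mulr1 ?normr1 ?scale1r//.
  by move=> z Zz; rewrite scale1r; apply: ha0; exact: Zj.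
have c1 : cstar_clifford_sub iota j Zperp a1.
  apply: (@supercommuting_in_closure (-1));
    rewrite ?mulrNN ?mulr1 ?normrN1 ?scaleN1r//.
  move=> z Zz; rewrite scaleN1r ha1; last exact: Zj.
  by rewrite gamma_j g_iota (raddfN j) cmulNr.
have hZp := clifford_sub_subalgebra iota Zperp.
move=> B /nbhs_ballP[e /= e0 aB].
have e20 : 0 < e / 2 by rewrite divr_gt0.
have [_ [[x0 Zx0 <-] ax0]] := c0 _ (nbhsx_ballx a0 _ e20).
have [_ [[x1 Zx1 <-] ax1]] := c1 _ (nbhsx_ballx a1 _ e20).
exists (j (x0 + x1)); split.
  by exists (x0 + x1) => //; exact: (subalgebraD hZp).
apply: aB; move: ax0 ax1; rewrite -ball_normE/= => ax0 ax1.
rewrite (raddfD j) opprD addrACA (splitr e).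
exact: le_lt_trans (ler_normD _ _) (ltrD ax0 ax1).
Qed.

(** The required decomposition of [a] is into its two parity parts. *)
Lemma sub_supercommutant :
  cstar_clifford_sub iota j Zperp `<=`
  supercommutant gamma (cstar_clifford_sub iota j Z).
Proof.
move=> a Za.
(* Both sides are continuous in [a], so it suffices to take [a] in the image of C(Z^perp), where z c
   = g(c) z and c z = z g(c). *)
have part_comm s z : s * s = 1 -> Z z ->
    j (iota z) ** parity_part s a = s *: (parity_part s a ** j (iota z)).
  move=> ss Zz.
  apply: (@eq_on_closure _ _ (cmul (j (iota z)) \o parity_part s)
    (fun x => s *: (parity_part s x ** j (iota z)))) Za.
  - move=> x; apply: continuous_comp; first exact: parity_part_continuous.
    exact: cmull_continuous.
  - move=> x; apply: cvgZr.
    apply: (continuous_comp (g := fun y => y ** j (iota z))).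
      exact: parity_part_continuous.
    exact: cmulr_continuous.
  move=> _ [c Zc <-] /=.
  rewrite parity_part_j -!jM -(linearZ_LR j); congr (j _).
  have zperp w : Zperp w -> ip w z = 0 by exact.
  rewrite -!scalerAr -!scalerAl mulrDr mulrDl -!scalerAr -!scalerAl.
  rewrite (iota_clifford_sub cliff g_iota zperp Zc).
  rewrite -(clifford_sub_iotar cliff g_iota zperp Zc).
  by rewrite !scalerDr !scalerA (mulrCA s) ss mulr1 (mulrC s) addrC.
(* Extends a commutation rule from vectors of [Z] to the algebra they generate and then to its
   closure; used with [f] the identity for the even part and [f = g] for the odd one. *)
have commute_gen (f : {lrmorphism C -> C}) (gf : A -> A) x :
    continuous gf -> (forall c, gf (j c) = j (f c)) ->
    (forall z, Z z -> j (iota z) ** x = x ** j (f (iota z))) ->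
    forall b, cstar_clifford_sub iota j Z b -> b ** x = x ** gf b.
  move=> gfc gfj hx.
  apply: eq_on_closure.
  - exact: cmulr_continuous.
  - by move=> y; apply: continuous_comp; [exact: gfc|exact: cmull_continuous].
  move=> _ [c Zc <-]; rewrite gfj.
  move: c Zc.
  apply: (clifford_sub_le (X := [set c | j c ** x = x ** j (f c)])) => //.
  split=> /=.
  - by rewrite rmorph1 j1 cmul1x cmulx1.
  - move=> k c d hc hd; rewrite (linearP f)/= !(linearP j) cmulDl cmulDr.
    by rewrite cmulZl cmulZr hc hd.
  - by move=> c d hc hd; rewrite rmorphM/= !jM -cmulA hd cmulA hc -cmulA.
exists (parity_part 1 a).
  split; first by rewrite /even_part/= gamma_parity_part ?mulr1// scale1r.
  apply: (@commute_gen idfun id) => // [x|z Zz]; first exact: cvg_id.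
  by rewrite part_comm ?mulr1// scale1r.
exists (parity_part (-1) a).
  split.
    by rewrite /odd_part/= gamma_parity_part ?mulrNN ?mulr1// scaleN1r.
  apply: (@commute_gen g) => // z Zz.
  by rewrite part_comm ?mulrNN ?mulr1// g_iota (raddfN j) cmulNr scaleN1r.
rewrite /parity_part -scalerDr scale1r scaleN1r addrACA subrr addr0.
by rewrite scaler_half_double.
Qed.

End Supercommutant.

Theorem theorem1 (R : realType)
  (V : completeNormedModType R) (ip : {dot V for idfun})
  (hV : norm_from_dot ip)
  (C : algType R[i]) (iota : V -> C) (hC : is_clifford_algebra ip iota)
  (star : C -> C) (hstar : is_clifford_involution iota star)
  (N : C -> R) (hN : is_cstar_norm star N)
  (A : cstarAlgType R) (j : {linear C -> A})
  (hA : is_cstar_completion star N j)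
  (gamma : A -> A) (hgamma : is_grading iota j gamma)
  (Z : set V) (hZ : closed_subspace Z) :
  supercommutant gamma (cstar_clifford_sub iota j Z)
  = cstar_clifford_sub iota j (orthogonal_complement ip Z).
Proof.
have [cliff _ iota_gen _] := hC; have [j1 jM jstar _ j_dense] := hA.
have [gamma_cont [g [_ g_iota] gamma_j]] := hgamma.
(* Selfadjointness of vectors passes along [j]; it underlies the bound by 1 on the norms of unit
   vectors. *)
have j_iota v : cstar (j (iota v)) = j (iota v).
  by case: hstar => _ _ _ _ star_iota; rewrite -jstar star_iota.
apply/seteqP; split.
  exact: (supercommutant_sub hV cliff iota_gen g_iota).
exact: (sub_supercommutant cliff iota_gen g_iota).
Qed.
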